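(* Let $C$ be a compact convex subset of $\mathbb{R}^n$. Let $f:C\to\mathbb{R}$ be a convex function, and let $G:C\to\mathbb{R}^n$ be a continuous mapping. Then there exists a convex function $F\in C^1(\mathbb{R}^n)$ with $F=f$ on $C$ and $\nabla F=G$ on $C$ if and only if both of the following conditions hold: (a) for every $\varepsilon>0$ there is $\delta>0$ such that $|f(z)-f(y)-\langle G(y),z-y\rangle|\le\varepsilon|z-y|$ for all $y,z\in C$ with $|z-y|\le\delta$; (b) for all $x,y\in C$: if $f(x)-f(y)=\langle G(y),x-y\rangle$, then $G(x)=G(y)$. *)

(* Defs.v *)
From mathcomp Require Import all_boot all_order all_algebra.
From mathcomp Require Import all_classical all_reals all_analysis.
Set Implicit Arguments.
Unset Strict Implicit.
Unset Printing Implicit Defensive.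
Import Order.TTheory GRing.Theory Num.Theory.
Import numFieldNormedType.Exports.
Local Open Scope classical_set_scope.
Local Open Scope ring_scope.

Definition dotp (R : realType) (n : nat) (u v : 'rV[R]_n) : R :=
  \sum_(i < n) u 0 i * v 0 i.

(* The library norm `|u| on 'rV[R]_n is the sup norm, hence a separate
   Euclidean norm; both induce the same topology. *)
Definition enorm (R : realType) (n : nat) (u : 'rV[R]_n) : R :=
  Num.sqrt (dotp u u).

(* 'D_v F x is a junk value when the directional derivative does not exist, so
   gradient F x is meaningful only where F has partial derivatives. *)
Definition gradient (R : realType) (n : nat) (F : 'rV[R]_n -> R)
    (x : 'rV[R]_n) : 'rV[R]_n :=
  \row_(i < n) 'D_(delta_mx 0 i) F x.

Definition C1 (R : realType) (n : nat) (F : 'rV[R]_n -> R) : Prop :=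
  (forall x : 'rV[R]_n, differentiable F x) /\ continuous (gradient F).

(* Main.v *)
Require Import Defs.
From HB Require Import structures.
From mathcomp Require Import all_boot all_order all_algebra ring lra.
From mathcomp Require Import all_classical all_reals all_analysis.
Set Implicit Arguments.
Unset Strict Implicit.
Unset Printing Implicit Defensive.
Import Order.TTheory GRing.Theory Num.Theory.
Import numFieldNormedType.Exports.
Local Open Scope classical_set_scope.
Local Open Scope ring_scope.

(** Necessity: convexity gives [0 <= F z - F y - <G y, z - y> <=
    <G z - G y, z - y>], so (a) is the uniform continuity of [G] on [C]; in (b)
    the tangent plane at [y] touches the graph at [x], hence is tangent there.

    Sufficiency, by duality.  Put [D x y = f x - f y - <G y, x - y>].  By (a)
    and convexity [D >= 0] on [C], and by (b) and compactness
    [D x y >= zeta (|G x - G y|^2)] for a convex [zeta] with [zeta 0 = 0] and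
    [zeta > 0] on positive reals.  The function
      [H p = sup_(y in C) (<p, y> - f y + zeta (|p - G y|^2))]
    is uniformly convex, coercive, and the lower bound on [D] says exactly that
    [H (G x) = <G x, x> - f x] with [x] a subgradient of [H] at [G x], for [x]
    in [C].  The convex conjugate of [H] is therefore of class C^1, and it has
    value [f x] and gradient [G x] at each [x] in [C]. *)

(** * Euclidean inner product, its comparison with the sup norm, and gradients *)

Section DotProduct.
Variables (R : realType) (n : nat).
Implicit Types (u v w : 'rV[R]_n) (a : R).

Lemma dotpC u v : dotp u v = dotp v u.
Proof. by apply: eq_bigr => i _; rewrite mulrC. Qed.

Lemma dotpDl u v w : dotp (u + v) w = dotp u w + dotp v w.
Proof. by rewrite -big_split; apply: eq_bigr => i _; rewrite mxE mulrDl. Qed.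

Lemma dotpZl a u w : dotp (a *: u) w = a * dotp u w.
Proof. by rewrite mulr_sumr; apply: eq_bigr => i _; rewrite mxE mulrA. Qed.

Lemma dotpDr w u v : dotp w (u + v) = dotp w u + dotp w v.
Proof. by rewrite dotpC dotpDl !(dotpC w). Qed.

Lemma dotpZr w a u : dotp w (a *: u) = a * dotp w u.
Proof. by rewrite dotpC dotpZl (dotpC w). Qed.

Lemma dotpNl u w : dotp (- u) w = - dotp u w.
Proof. by rewrite -scaleN1r dotpZl mulN1r. Qed.

Lemma dotpNr w u : dotp w (- u) = - dotp w u.
Proof. by rewrite dotpC dotpNl dotpC. Qed.

Lemma dotp0l w : dotp 0 w = 0.
Proof. by rewrite -(scale0r 0) dotpZl mul0r. Qed.

Lemma dotp0r w : dotp w 0 = 0.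
Proof. by rewrite dotpC dotp0l. Qed.

Definition dotpE := (dotpDl, dotpDr, dotpNl, dotpNr, dotpZl, dotpZr).

(** The parallelogram law, in the form needed for midpoint convexity of [dual]. *)
Lemma dotp_midpoint u v :
  dotp (2^-1 *: (u + v)) (2^-1 *: (u + v)) + dotp (u - v) (u - v) / 4 =
  (dotp u u + dotp v v) / 2.
Proof. rewrite !dotpE (dotpC v u); lra. Qed.

Lemma dotp_delta u (i : 'I_n) : dotp u (delta_mx 0 i) = u 0 i.
Proof.
rewrite /dotp (bigD1 i)//= big1 ?addr0 => [|j /negPf ji].
  by rewrite mxE !eqxx mulr1.
by rewrite mxE ji andbF mulr0.
Qed.

Lemma coord_le_norm u (i : 'I_n) : `|u 0 i| <= `|u|.
Proof. by rewrite [leRHS]mx_normrE; apply: (le_bigmax _ _ (0, i)). Qed.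

Lemma dotp_le_norm u v : `|dotp u v| <= n%:R * (`|u| * `|v|).
Proof.
rewrite (le_trans (ler_norm_sum _ _ _))//.
rewrite -[n in n%:R]card_ord mulr_natl -sumr_const ler_sum// => i _.
by rewrite normrM ler_pM// coord_le_norm.
Qed.

Lemma dotp_ge0 u : 0 <= dotp u u.
Proof. by apply: sumr_ge0 => i _; exact: sqr_ge0. Qed.

Lemma sqr_norm_le_dotp u : `|u| ^+ 2 <= dotp u u.
Proof.
have [->|u0] := eqVneq `|u| 0; first by rewrite expr0n dotp_ge0.
have [[i j] uij] := mx_norm_neq0 u0.
have -> : `|u| = `|u i j| by exact: uij.
rewrite (ord1 i) real_normK ?num_real// /dotp (bigD1 j)//= expr2 lerDl.
by apply: sumr_ge0 => k _; exact: sqr_ge0.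
Qed.

Lemma norm_le_enorm u : `|u| <= enorm u.
Proof.
by rewrite -[leLHS]normr_id -sqrtr_sqr; apply/ler_wsqrtr/sqr_norm_le_dotp.
Qed.

Lemma enorm_le_norm u : enorm u <= n%:R * `|u|.
Proof.
rewrite -[leRHS]ger0_norm ?mulr_ge0// -sqrtr_sqr; apply: ler_wsqrtr.
apply: (le_trans (ler_norm _)); apply: (le_trans (dotp_le_norm u u)).
rewrite -expr2 exprMn ler_wpM2r ?sqr_ge0//.
by rewrite -natrX ler_nat; case: (n) => // m; rewrite leq_pmulr.
Qed.

Lemma cvg_dotp (T : Type) (F : set_system T) {FF : Filter F}
    (u v : T -> 'rV[R]_n) (a b : 'rV[R]_n) :
  u @ F --> a -> v @ F --> b -> (fun t => dotp (u t) (v t)) @ F --> dotp a b.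
Proof.
move=> ua vb; rewrite /dotp.
apply: cvg_big => [|i _]; first exact: add_continuous.
by apply: cvgM; apply: (continuous_cvg _ (@coord_continuous _ _ _ 0 i _)).
Qed.

Lemma dotp_is_linear u : linear (dotp u : _ -> R^o).
Proof. by move=> a v w; rewrite dotpDr dotpZr. Qed.
HB.instance Definition _ u :=
  GRing.isLinear.Build R 'rV[R]_n R^o *:%R (dotp u) (dotp_is_linear u).

Lemma dotp_continuous u : continuous (dotp u).
Proof.
move=> v; apply: (@cvg_dotp _ (nbhs v) _ (cst u) id); first exact: cvg_cst.
exact: cvg_id.
Qed.

Lemma dotp_continuousl u : continuous (fun v : 'rV[R]_n => dotp v u).
Proof.
move=> v; apply: (@cvg_dotp _ (nbhs v) _ id (cst u)); first exact: cvg_id.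
exact: cvg_cst.
Qed.

(** Uniqueness of the differential identifies ['d F x] with the continuous linear form [dotp g],
    whose coordinates are those of [g]. *)
Lemma differentiable_dotp (F : 'rV[R]_n -> R) (x g : 'rV[R]_n) :
  (forall eps : R, 0 < eps ->
    \forall h \near (0 : 'rV[R]_n),
      `|F (h + x) - F x - dotp g h| <= eps * `|h|) ->
  differentiable F x /\ gradient F x = g.
Proof.
move=> H.
have E : F \o shift x = cst (F x) + dotp g +o_ (0 : 'rV[R]_n) id.
  apply/eqaddoP => eps e0; near=> h.
  rewrite /= !fctE /= opprD addrA; near: h; exact: H.
have d : 'd F x = dotp g :> (_ -> _).
  by apply: (diff_unique _ E); exact: dotp_continuous.
have dF : differentiable F x.
  apply/diff_locallyP; rewrite d; split=> //; exact: dotp_continuous.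
split=> //; apply/rowP => i.
by rewrite mxE deriveE// d dotp_delta.
Unshelve. all: by end_near. Qed.

Lemma diff_gradient (F : 'rV[R]_n -> R) (x v : 'rV[R]_n) :
  differentiable F x -> 'D_v F x = dotp (gradient F x) v.
Proof.
move=> dF; rewrite deriveE// {1}(row_sum_delta v) linear_sum/=.
by apply: eq_bigr => i _; rewrite linearZ/= mxE deriveE// mulrC.
Qed.

End DotProduct.

(* Minimise [u + max 0 (eps - v)], which is positive on [K]. *)
Lemma compact_modulus (T : topologicalType) (R : realType) (K : set T)
    (u v : T -> R) (eps : R) :
  compact K -> {within K, continuous u} -> {within K, continuous v} ->
  (forall t, K t -> 0 <= u t) -> (forall t, K t -> u t = 0 -> v t <= 0) ->
  0 < eps -> exists2 mu : R, 0 < mu & forall t, K t -> u t < mu -> v t < eps.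
Proof.
move=> cK cu cv u0 uv e0.
have [K0|nK] := pselect (K !=set0); last first.
  by exists 1 => // t Kt; case: nK; exists t.
have cw : {within K, continuous (fun t => u t + Num.max 0 (eps - v t))}.
  move=> t; apply: cvgD; first exact: cu.
  apply: (@continuous_max R (subspace K) (cst 0) (fun t => eps - v t) t).
    exact: cvg_cst.
  by apply: cvgB; [exact: cvg_cst|exact: cv].
have [c /set_mem Kc cmin] := compact_EVT_min K0 cK cw.
exists (u c + Num.max 0 (eps - v c)).
  have := u0 _ Kc; rewrite le_eqVlt => /predU1P[/esym uc|uc].
    by rewrite uc add0r lt_max subr_gt0 (le_lt_trans (uv _ Kc uc)) ?orbT.
  by rewrite ltr_wpDr// le_max lexx.
move=> t Kt; apply: contraTT; rewrite -!leNgt => vt.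
rewrite (le_trans (cmin _ (mem_set Kt)))//.
by rewrite max_l ?addr0// subr_le0.
Qed.

(** * The convex conjugate of a uniformly convex coercive function is of class C^1 *)

Section UniformlyConvexConjugate.
Variables (R : realType) (n : nat) (H : 'rV[R]_n -> R) (zeta : R -> R).
Implicit Types (p q x y : 'rV[R]_n).

(** The supremum defining the convex conjugate of [H] at [x] is attained at [p]; equivalently, [x]
    is a subgradient of [H] at [p]. *)
Definition conj_argmax x p := forall q, dotp q x - H q <= dotp p x - H p.

Hypothesis H_continuous : continuous H.
Hypothesis H_coercive :
  exists a b c : R, 0 < a /\ forall p, a * `|p| ^+ 2 - b * `|p| - c <= H p.
Hypothesis zeta_gt0 : forall s : R, 0 < s -> 0 < zeta s.
(** Star-shapedness: [zeta s / s] is nondecreasing for positive [s], so positivity at one scale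
    gives linear growth beyond it. *)
Hypothesis zeta_star : forall l s : R, 0 <= l -> l <= 1 -> 0 <= s ->
  zeta (l * s) <= l * zeta s.
Hypothesis H_midpoint : forall p q, H (2^-1 *: (p + q)) <=
  (H p + H q) / 2 - zeta (dotp (p - q) (p - q) / 4).

Lemma conj_argmax_exists x : exists p, conj_argmax x p.
Proof.
have [a [b [c [a0 Hp]]]] := H_coercive.
(* For [|q| >= rho >= 1], the quadratic term [a * |q|^2] is at least [k * |q|], which makes the
   objective at [q] at most its value [- H 0] at the origin. The maximum over the ball is therefore
   global. *)
pose k := n%:R * `|x| + `|b| + `|c + H 0|; pose rho := 1 + k / a.
have k0 : 0 <= k by rewrite !addr_ge0 ?mulr_ge0.
have rho1 : 1 <= rho by rewrite lerDl divr_ge0 // ltW.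
pose B := closed_ball (0 : 'rV[R]_n) rho.
have BE p : B p <-> `|p| <= rho.
  rewrite /B closed_ballE ?(lt_le_trans ltr01)// /closed_ball_/=.
  by rewrite sub0r normrN.
have cB : compact B.
  apply: bounded_closed_compact; last exact: closed_ball_closed.
  exists rho; split; first exact: num_real.
  by move=> M ltM p /BE /le_trans; apply; exact: ltW.
have B0 : B 0 by apply/BE; rewrite normr0 (le_trans ler01).
have cphi : {within B, continuous (fun p => dotp p x - H p)}.
  apply: continuous_subspaceT => p.
  exact: (cvgB (@dotp_continuousl _ _ x p) (@H_continuous p)).
have [p _ pmax] := compact_EVT_max (ex_intro _ _ B0) cB cphi.
exists p => q.
have [qr|qr] := leP `|q| rho; first by apply/pmax/mem_set/BE.
apply: le_trans (pmax _ (mem_set B0)); rewrite dotp0l sub0r.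
have := Hp q; have := le_trans (ler_norm _) (dotp_le_norm q x).
have ar : k * `|q| <= a * `|q| ^+ 2.
  rewrite expr2 mulrA ler_wpM2r// -ler_pdivrMl// mulrC.
  by rewrite (le_trans _ (ltW qr))// lerDr.
have q1 : 1 <= `|q| by rewrite (le_trans rho1)// ltW.
have h1 : `|c + H 0| <= `|c + H 0| * `|q| by rewrite ler_peMr.
have h2 : b * `|q| <= `|b| * `|q| by rewrite ler_wpM2r// ler_norm.
have := ler_norm (c + H 0).
move: ar h1 h2; rewrite /k !mulrDl.
lra.
Qed.

(* Test both maximality conditions at the midpoint of [p] and [q]. *)
Lemma conj_argmax_gap x y p q : conj_argmax x p -> conj_argmax y q ->
  4 * zeta (dotp (p - q) (p - q) / 4) <= dotp (p - q) (x - y).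
Proof.
move=> /(_ (2^-1 *: (p + q))) hp /(_ (2^-1 *: (p + q))) hq.
have := H_midpoint p q; move: hp hq; rewrite !dotpE.
lra.
Qed.

Lemma conj_argmax_unique x p q : conj_argmax x p -> conj_argmax x q -> p = q.
Proof.
move=> hp hq; have := conj_argmax_gap hp hq; rewrite subrr dotp0r => le0.
apply/eqP; rewrite -subr_eq0 -normr_eq0; apply: contraTT le0 => pq.
rewrite -ltNge mulr_gt0// zeta_gt0// divr_gt0//.
by rewrite (lt_le_trans _ (sqr_norm_le_dotp _))// exprn_gt0// lt0r pq normr_ge0.
Qed.

(** Suppose [t = |P x - P y| >= eps]. By [zeta_star] the left side of [conj_argmax_gap] is at least
    a constant times [t], while its right side is at most [n * t * |x - y|]. Cancelling [t] bounds
    [|x - y|] from below. *)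
Lemma conj_argmax_continuous (P : 'rV[R]_n -> 'rV[R]_n) :
  (forall x, conj_argmax x (P x)) -> continuous P.
Proof.
move=> HP x; apply/(@cvgrPdist_lt _ _ _ (nbhs x)) => eps e0.
pose z0 := zeta (eps ^+ 2 / 4).
have z00 : 0 < z0 by rewrite zeta_gt0// divr_gt0// exprn_gt0.
(* Here and below, [n%:R + 1] absorbs the factor [n] of [dotp_le_norm] and stays positive when
   [n = 0]. *)
have d0 : 0 < 4 * z0 / (eps * (n%:R + 1)).
  by rewrite divr_gt0 ?mulr_gt0 ?ltr_wpDl.
apply/(@nbhs_normP R _ x); exists (4 * z0 / (eps * (n%:R + 1))) => // y /= xy.
rewrite ltNge; apply/negP => le_eps.
set t := `|P x - P y| in le_eps.
have t0 : 0 < t by rewrite (lt_le_trans e0).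
have := conj_argmax_gap (HP x) (HP y).
set s := dotp (P x - P y) (P x - P y).
have es : eps * t <= s.
  apply: le_trans (sqr_norm_le_dotp _); rewrite expr2 ler_wpM2r//; exact: ltW.
have s0 : 0 < s by rewrite (lt_le_trans _ es)// mulr_gt0.
have l1 : eps ^+ 2 / s <= 1.
  rewrite ler_pdivrMr// mul1r (le_trans _ es)// expr2 ler_wpM2l// ltW//.
have := @zeta_star (eps ^+ 2 / s) (s / 4).
have -> : eps ^+ 2 / s * (s / 4) = eps ^+ 2 / 4 by rewrite mulrA divfK// gt_eqF.
have l0 : 0 <= eps ^+ 2 / s by rewrite divr_ge0 ?sqr_ge0// ltW.
have s40 : 0 <= s / 4 by rewrite divr_ge0// ltW.
move=> /(_ l0 l1 s40); rewrite -/z0 => zs gap.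
have {}gap := le_trans gap (le_trans (ler_norm _) (dotp_le_norm _ _)).
have : z0 * s <= eps ^+ 2 * zeta (s / 4) by rewrite -ler_pdivlMr// mulrAC.
move: xy; rewrite ltr_pdivlMr ?mulr_gt0 ?ltr_wpDl// -/t => xy zs'.
have : z0 * (eps * t) <= eps ^+ 2 * zeta (s / 4).
  by rewrite (le_trans _ zs')// ler_wpM2l// ltW.
rewrite expr2 mulrCA -mulrA ler_pM2l// => zt.
have : 4 * (z0 * t) <= eps * (n%:R * (t * `|x - y|)).
  apply: (@le_trans _ _ (eps * (4 * zeta (s / 4)))); last first.
    by rewrite ler_wpM2l// ltW.
  by rewrite [leRHS]mulrCA ler_wpM2l.
have -> : eps * (n%:R * (t * `|x - y|)) = t * (`|x - y| * (eps * n%:R)) by ring.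
rewrite mulrA [_ * t]mulrC ler_pM2l// leNgt => /negP; apply.
rewrite (le_lt_trans _ xy)// ler_wpM2l// ler_wpM2l ?lerDl//; exact: ltW.
Qed.

(** A supremum of affine functions: the one attaining the value at [z] lies below the conjugate at
    [x] and at [y]. *)
Lemma conj_convex (P : 'rV[R]_n -> 'rV[R]_n) :
  (forall x, conj_argmax x (P x)) ->
  convex_function [set: 'rV[R]_n] (fun x => dotp (P x) x - H (P x)).
Proof.
move=> HP t x y _ _; set z := conv t x y.
change (dotp (P z) z - H (P z) <= t%:num * (dotp (P x) x - H (P x)) +
  (1 - t%:num) * (dotp (P y) y - H (P y))).
have zE : z = t%:num *: x + (1 - t%:num) *: y by [].
have hx := HP x (P z); have hy := HP y (P z).
rewrite zE dotpDr !dotpZr.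
have t0 : 0 <= t%:num by [].
have t1 : 0 <= 1 - t%:num by rewrite subr_ge0.
have := ler_wpM2l t0 hx; have := ler_wpM2l t1 hy.
lra.
Qed.

(** Testing each of the maximisers at [x] and [h + x] against the other places
    [F (h + x) - F x - dotp (P x) h] between 0 and [dotp (P (h + x) - P x) h], which is o(h) by
    continuity of [P]. *)
Lemma conj_C1 (P : 'rV[R]_n -> 'rV[R]_n) :
  (forall x, conj_argmax x (P x)) ->
  let F x := dotp (P x) x - H (P x) in C1 F /\ gradient F = P.
Proof.
move=> HP F.
have dF x : differentiable F x /\ gradient F x = P x.
  apply: differentiable_dotp => eps e0.
  have d0 : 0 < eps / (n%:R + 1) by rewrite divr_gt0 ?ltr_wpDl.
  have /(@cvgrPdist_lt _ _ _ (nbhs x))/(_ _ d0) :=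
    @conj_argmax_continuous P HP x.
  move=> /(@nbhs_normP R _ x)[d /= dgt0 Pd].
  apply/(@nbhs_normP R _ 0); exists d => // h /=; rewrite sub0r normrN => hd.
  have Ph : `|P x - P (h + x)| < eps / (n%:R + 1).
    by apply: Pd; rewrite /= opprD addrCA subrr addr0 normrN.
  have h1 := HP x (P (h + x)); have h2 := HP (h + x) (P x).
  have h3 : F (h + x) - F x - dotp (P x) h <= dotp (P (h + x) - P x) h.
    move: h1; rewrite /F !dotpE; lra.
  rewrite ger0_norm; last by move: h2; rewrite /F !dotpE; lra.
  rewrite (le_trans h3)// (le_trans (ler_norm _))//.
  rewrite (le_trans (dotp_le_norm _ _))// mulrA ler_wpM2r// distrC.
  move: Ph; rewrite ltr_pdivlMr ?ltr_wpDl// => /ltW; apply: le_trans.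
  by rewrite mulrC ler_wpM2l// lerDl.
have gF : gradient F = P by apply/funext => x; case: (dF x).
split=> //; split; first by move=> x; case: (dF x).
by rewrite gF; exact: conj_argmax_continuous.
Qed.

End UniformlyConvexConjugate.

(** * The modulus [zeta] extracted from the Bregman gap *)

Section ConjugateOfExtension.
Variables (R : realType) (n : nat) (C : set 'rV[R]_n).
Variables (f : 'rV[R]_n -> R) (G : 'rV[R]_n -> 'rV[R]_n).
Implicit Types (p q x y : 'rV[R]_n) (a e r s : R).

Definition bregman x y := f x - f y - dotp (G y) (x - y).

Let gap x y := dotp (G x - G y) (G x - G y).

(** The bound [a <= 1] makes the supremum [modulus] finite and 1-Lipschitz on nonnegative reals;
    [0 <= e] makes it star-shaped. *)
Definition admissible a e := [/\ 0 <= a, a <= 1, 0 <= e &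
  forall x y, C x -> C y -> a * gap x y - e <= bregman x y].

(* [zeta]: a convex minorant of [bregman x y] in the variable [|G x - G y|^2],
   the supremum of its affine minorants with slope in [0, 1] and nonpositive
   value at 0. *)
Definition modulus s :=
  sup [set r | exists a e, admissible a e /\ r = a * s - e].

(** Over [y] in [C], the first two terms have as supremum the conjugate of [f] restricted to [C];
    the penalty centred at [G y] adds uniform convexity in [p]. *)
Definition dual_piece y p :=
  dotp p y - f y + modulus (dotp (p - G y) (p - G y)).

Definition dual p := sup [set dual_piece y p | y in C].

Hypothesis bregman_ge0 : forall x y, C x -> C y -> 0 <= bregman x y.

Lemma admissible00 : admissible 0 0.
Proof. by split=> // x y Cx Cy; rewrite mul0r subrr bregman_ge0. Qed.

Lemma modulus_ge s a e : 0 <= s -> admissible a e -> a * s - e <= modulus s.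
Proof.
move=> s0 ae; apply: ub_le_sup; last by exists a, e.
exists s => _ [b [d [[b0 b1 d0 _] ->]]].
by rewrite lerBlDr (le_trans (ler_wpM2r s0 b1))// mul1r lerDl.
Qed.

Lemma modulus_le s r :
  (forall a e, admissible a e -> a * s - e <= r) -> modulus s <= r.
Proof.
move=> sr; apply: ge_sup; last by move=> _ [a [e [ae ->]]]; exact: sr.
by exists (0 * s - 0), 0, 0; split=> //; exact: admissible00.
Qed.

Lemma modulus_ge0 s : 0 <= s -> 0 <= modulus s.
Proof.
by move=> s0; have := modulus_ge s0 admissible00; rewrite mul0r subr0.
Qed.

Lemma modulus_le_id s : 0 <= s -> modulus s <= s.
Proof.
move=> s0; apply: modulus_le => a e [a0 a1 e0 _].
by rewrite lerBlDr (le_trans (ler_wpM2r s0 a1))// mul1r lerDl.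
Qed.

Lemma modulus_gap_le x y : C x -> C y -> modulus (gap x y) <= bregman x y.
Proof. by move=> Cx Cy; apply: modulus_le => a e [_ _ _]; exact. Qed.

(** An affine function with nonpositive value at 0 is star-shaped, and suprema preserve this. *)
Lemma modulus_star l s : 0 <= l -> l <= 1 -> 0 <= s ->
  modulus (l * s) <= l * modulus s.
Proof.
move=> l0 l1 s0; apply: modulus_le => a e ae.
have [_ _ e0 _] := ae.
have := ler_wpM2l l0 (modulus_ge s0 ae); apply: le_trans.
by rewrite mulrBr mulrCA lerD2l lerN2 ler_piMl.
Qed.

(** Apply [modulus_star] with the ratios [r / (r + s)] and [s / (r + s)], which add up to 1. *)
Lemma modulus_superadditive r s : 0 <= r -> 0 <= s ->
  modulus r + modulus s <= modulus (r + s).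
Proof.
move=> r0 s0; have := addr_ge0 r0 s0; rewrite le_eqVlt => /predU1P[rs|rs].
  have r00 : r = 0 by lra.
  have s00 : s = 0 by lra.
  by rewrite r00 s00 addr0 gerDl modulus_le_id.
have star t : 0 <= t -> t <= r + s ->
    modulus t <= t / (r + s) * modulus (r + s).
  move=> t0 trs; rewrite -{1}(divfK (lt0r_neq0 rs) t).
  by apply: modulus_star; rewrite ?divr_ge0 ?ler_pdivrMr ?mul1r// ltW.
apply: (le_trans (lerD (star r r0 _) (star s s0 _))); rewrite ?lerDl ?lerDr//.
by rewrite -mulrDl -mulrDl divff ?mul1r// gt_eqF.
Qed.

Lemma modulus_midpoint r s : 0 <= r -> 0 <= s ->
  modulus ((r + s) / 2) <= (modulus r + modulus s) / 2.
Proof.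
move=> r0 s0; apply: modulus_le => a e ae.
have := modulus_ge r0 ae; have := modulus_ge s0 ae; lra.
Qed.

Lemma modulus_lipschitz r s : 0 <= s -> modulus r - modulus s <= `|r - s|.
Proof.
move=> s0; rewrite lerBlDr; apply: modulus_le => a e ae.
have [a0 a1 _ _] := ae; have := modulus_ge s0 ae.
have : a * (r - s) <= `|r - s|.
  rewrite (le_trans (ler_norm _))// normrM (ger0_norm a0).
  by rewrite -[leRHS]mul1r ler_wpM2r.
lra.
Qed.

Variable B : R.
Hypothesis C_bounded : forall y, C y -> `|y| <= B.
Hypothesis f_bounded : forall y, C y -> `|f y| <= B.
Hypothesis G_bounded : forall y, C y -> `|G y| <= B.
Variable y0 : 'rV[R]_n.
Hypothesis Cy0 : C y0.
Hypothesis bregman_modulus : forall eps, 0 < eps -> exists2 mu : R, 0 < mu &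
  forall x y, C x -> C y -> bregman x y < mu -> gap x y < eps.

Lemma B_ge0 : 0 <= B.
Proof. exact: le_trans (C_bounded Cy0). Qed.

(** The witness is a line of small slope [a] vanishing at [s / 2]. Where the gap is below [s / 2]
    the line is negative and [bregman] is not; elsewhere [bregman] is at least [mu], and the slope
    keeps the line below [mu]. *)
Lemma modulus_gt0 s : 0 < s -> 0 < modulus s.
Proof.
move=> s0; have s20 : 0 < s / 2 by rewrite divr_gt0.
have [mu mu0 Hmu] := bregman_modulus s20.
(* [M] bounds every [gap x y] on [C], because [|G x - G y| <= 2 * B]. *)
pose M := n%:R * ((2 * B) * (2 * B)) + 1.
have B2 : 0 <= 2 * B by rewrite mulr_ge0// B_ge0.
have M0 : 0 < M.
  by apply: ltr_wpDl => //; apply: mulr_ge0 => //; exact: mulr_ge0.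
pose a := Num.min 1 (mu / M).
have a0 : 0 < a by rewrite lt_min ltr01 divr_gt0.
have ae : admissible a (a * (s / 2)).
  split=> [|||x y Cx Cy]; first exact: ltW.
  - by rewrite ge_min lexx.
  - by apply: mulr_ge0; exact: ltW.
  rewrite -mulrBr; have [small|large] := ltP (gap x y) (s / 2).
    rewrite (le_trans _ (bregman_ge0 Cx Cy))// nmulr_lle0.
      exact: ltW.
    by rewrite subr_lt0.
  have : mu <= bregman x y.
    by rewrite leNgt; apply/negP => /(Hmu _ _ Cx Cy); rewrite ltNge large.
  apply: le_trans; apply: (@le_trans _ _ (mu / M * M)); last first.
    by rewrite divfK// gt_eqF.
  apply: ler_pM; rewrite ?subr_ge0 ?ge_min ?lexx ?orbT//; first exact: ltW.
  rewrite lerBlDr /M -addrA; apply: le_trans (ler_norm _) _.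
  rewrite (le_trans (dotp_le_norm _ _))// ler_wpDr//.
    by apply: addr_ge0 => //; exact: ltW.
  have Gxy : `|G x - G y| <= 2 * B.
    by rewrite (le_trans (ler_normB _ _))// mulr2n mulrDl mul1r lerD ?G_bounded.
  by rewrite ler_wpM2l// ler_pM.
apply: lt_le_trans (modulus_ge (ltW s0) ae).
by rewrite -mulrBr mulr_gt0// subr_gt0 ltr_pdivrMr// mulr_natr mulr2n ltrDl.
Qed.

(** * The dual function: uniform convexity, continuity, coercivity, and contact at the points
    [G x] *)

Lemma dual_ge y p : C y -> dual_piece y p <= dual p.
Proof.
move=> Cy; apply: ub_le_sup; last by exists y.
(* The summands bound the three terms of [dual_piece] uniformly in [z], the last one through
   [modulus_le_id]. *)
exists (n%:R * (`|p| * B) + B + n%:R * ((`|p| + B) * (`|p| + B))).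
move=> _ [z Cz <-].
apply: lerD; last first.
  rewrite (le_trans (modulus_le_id (dotp_ge0 _)))// (le_trans (ler_norm _))//.
  rewrite (le_trans (dotp_le_norm _ _))// ler_wpM2l//.
  by rewrite ler_pM// (le_trans (ler_normB _ _))// lerD2l G_bounded.
apply: lerD; last by rewrite (le_trans (ler_norm _))// normrN f_bounded.
rewrite (le_trans (ler_norm _))// (le_trans (dotp_le_norm _ _))//.
by rewrite ler_wpM2l// ler_wpM2l// C_bounded.
Qed.

Lemma dual_le p r : (forall y, C y -> dual_piece y p <= r) -> dual p <= r.
Proof.
move=> pr; apply: ge_sup; last by move=> _ [y Cy <-]; exact: pr.
by exists (dual_piece y0 p), y0.
Qed.

(** For each [y], the parallelogram law for [p - G y] and [q - G y] combines with superadditivity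
    and midpoint convexity of [modulus]. The term split off depends on [p - q] only, hence survives
    the supremum over [y]. *)
Lemma dual_midpoint p q : dual (2^-1 *: (p + q)) <=
  (dual p + dual q) / 2 - modulus (dotp (p - q) (p - q) / 4).
Proof.
apply: dual_le => y Cy; have := dual_ge p Cy; have := dual_ge q Cy.
rewrite /dual_piece.
set u := p - G y; set v := q - G y.
have -> : 2^-1 *: (p + q) - G y = 2^-1 *: (u + v).
  apply/rowP => i; rewrite !mxE; lra.
have -> : p - q = u - v by rewrite /u /v opprB addrA subrK.
have sum := dotp_midpoint u v.
have uv0 : 0 <= dotp (u - v) (u - v) / 4 by rewrite divr_ge0 ?dotp_ge0.
have := modulus_superadditive (dotp_ge0 (2^-1 *: (u + v))) uv0.
rewrite sum.
have := modulus_midpoint (dotp_ge0 u) (dotp_ge0 v).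
rewrite (dotpZl _ (p + q)) (dotpDl p q).
lra.
Qed.

(** [modulus] is 1-Lipschitz and the difference of the two squares factors through [p - q]. In
    [3 * B], one [B] bounds [y] and two bound [G y + G y]. *)
Lemma dual_local_lipschitz p q :
  dual p - dual q <= n%:R * (`|p - q| * (3 * B + `|p| + `|q|)).
Proof.
rewrite lerBlDr; apply: dual_le => y Cy.
have := dual_ge q Cy; rewrite /dual_piece.
have := modulus_lipschitz (dotp (p - G y) (p - G y)) (dotp_ge0 (q - G y)).
have -> : dotp (p - G y) (p - G y) - dotp (q - G y) (q - G y) =
    dotp (p - q) (p + q - (G y + G y)).
  by rewrite !dotpE (dotpC q p) (dotpC (G y) p) (dotpC (G y) q); ring.
have := dotp_le_norm (p - q) (p + q - (G y + G y)).
have : n%:R * (`|p - q| * `|p + q - (G y + G y)|) <=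
    n%:R * (`|p - q| * (`|p| + `|q| + (B + B))).
  rewrite ler_wpM2l// ler_wpM2l// (le_trans (ler_normB _ _))//.
  rewrite lerD ?ler_normD//.
  by rewrite (le_trans (ler_normD _ _))// lerD ?G_bounded.
have : n%:R * (`|p - q| * `|y|) <= n%:R * (`|p - q| * B).
  by rewrite ler_wpM2l// ler_wpM2l// C_bounded.
have := le_trans (ler_norm _) (dotp_le_norm (p - q) y); rewrite dotpDl dotpNl.
rewrite !mulrDr; lra.
Qed.

Lemma dual_continuous : continuous dual.
Proof.
move=> p; apply/(@cvgrPdist_lt _ _ _ (nbhs p)) => eps e0.
pose K := n%:R * (3 * B + `|p| + (`|p| + 1)) + 1.
have K0 : 0 < K.
  by rewrite ltr_wpDl// mulr_ge0// !addr_ge0// mulr_ge0// B_ge0.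
apply/(@nbhs_normP R _ p); exists (Num.min 1 (eps / K)).
  by rewrite /= lt_min ltr01 divr_gt0.
move=> q /=; rewrite lt_min ltr_pdivlMr// => /andP[pq1 pqK].
have q1 : `|q| <= `|p| + 1.
  rewrite -[q](subrK p) addrC (le_trans (ler_normD _ _))// lerD2l distrC.
  exact: ltW.
have le_eps r : r <= n%:R * (`|p - q| * (3 * B + `|p| + `|q|)) -> r < eps.
  move=> rle; apply: le_lt_trans pqK; apply: (le_trans rle).
  rewrite mulrCA ler_wpM2l// /K ler_wpDr// ler_wpM2l// lerD2l//.
rewrite ltr_norml ltrNl opprB; apply/andP; split; apply: le_eps.
  by rewrite distrC addrAC; exact: dual_local_lipschitz.
exact: dual_local_lipschitz.
Qed.

(** Since [modulus 1 > 0], some admissible line has positive slope [a]; the single piece at [y0]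
    then grows like [a * |p - G y0|^2]. *)
Lemma dual_coercive :
  exists a b c : R, 0 < a /\ forall p, a * `|p| ^+ 2 - b * `|p| - c <= dual p.
Proof.
have : 0 < modulus 1 by exact: modulus_gt0.
have [[a [e [ae ae0]]] _|none] :=
    pselect (exists a e, admissible a e /\ 0 < a * 1 - e); last first.
  rewrite ltNge modulus_le// => a e ae; rewrite leNgt; apply/negP => ae0.
  by apply: none; exists a, e.
have [a0 a1 e0 _] := ae.
exists a, (2 * B + n%:R * B), (B + e); split; first lra.
move=> p; apply: le_trans (dual_ge p Cy0); rewrite /dual_piece.
have := modulus_ge (dotp_ge0 (p - G y0)) ae.
have := sqr_norm_le_dotp (p - G y0) => /(ler_wpM2l a0).
have h1 : `|p| - B <= `|p - G y0|.
  by rewrite (le_trans _ (lerB_dist _ _))// lerD2l lerN2 G_bounded.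
have h2 : `|p| ^+ 2 - 2 * B * `|p| <= `|p - G y0| ^+ 2.
  (* The bound [h1] can be squared only when [|p| - B] is nonnegative; otherwise the left side is
     already nonpositive. *)
  have [pB|Bp] := leP `|p| B.
    rewrite (le_trans _ (sqr_ge0 _))// expr2 -mulrBl mulr_le0_ge0//.
    rewrite lerBlDr add0r.
    by have := B_ge0; lra.
  have : (`|p| - B) ^+ 2 <= `|p - G y0| ^+ 2.
    by rewrite ler_pXn2r// ?nnegrE// subr_ge0 ltW.
  by have := sqr_ge0 B; rewrite sqrrB; lra.
have h3 : a * (`|p| ^+ 2 - 2 * B * `|p|) <= a * `|p - G y0| ^+ 2.
  by rewrite ler_wpM2l.
have h4 : a * (2 * B * `|p|) <= 2 * B * `|p|.
  by rewrite ler_piMl// !mulr_ge0// B_ge0.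
have h5 : - dotp p y0 <= n%:R * (`|p| * B).
  rewrite (le_trans (ler_norm _))// normrN (le_trans (dotp_le_norm _ _))//.
  by rewrite ler_wpM2l// ler_wpM2l// C_bounded.
have h6 := le_trans (ler_norm _) (f_bounded Cy0).
move: h3; rewrite mulrBr; lra.
Qed.

Lemma dual_ge_affine p x : C x -> dotp p x - f x <= dual p.
Proof.
move=> Cx; apply: le_trans (dual_ge p Cx).
by rewrite lerDl modulus_ge0// dotp_ge0.
Qed.

(** The upper bound on the piece at [y] is [modulus_gap_le] for the pair [y], [x], rearranged: the
    penalty does not raise the dual at [G x]. *)
Lemma dual_G x : C x -> dual (G x) = dotp (G x) x - f x.
Proof.
move=> Cx; apply/eqP; rewrite eq_le dual_ge_affine// andbT.
apply: dual_le => y Cy; rewrite /dual_piece.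
have := modulus_gap_le Cy Cx; rewrite /gap /bregman.
have -> : dotp (G y - G x) (G y - G x) = dotp (G x - G y) (G x - G y).
  by rewrite -(opprB (G x)) dotpNl dotpNr opprK.
by rewrite dotpDr dotpNr; lra.
Qed.

Lemma conj_argmax_G x : C x -> conj_argmax dual x (G x).
Proof.
move=> Cx p; rewrite dual_G//.
by have := dual_ge_affine p Cx; lra.
Qed.

Lemma convex_C1_extension : exists F : 'rV[R]_n -> R,
  [/\ convex_function [set: 'rV[R]_n] F, C1 F,
      forall x, C x -> F x = f x & forall x, C x -> gradient F x = G x].
Proof.
have argmaxP x : exists p, conj_argmax dual x p.
  by apply: conj_argmax_exists; [exact: dual_continuous|exact: dual_coercive].
have [P HP] := choice argmaxP.
(* Uniqueness of the maximiser forces the chosen [P] to agree with [G] on [C], which fixes both the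
   gradient and the value there. *)
have PG x : C x -> P x = G x.
  move=> Cx; apply: (conj_argmax_unique modulus_gt0 dual_midpoint (HP x)).
  exact: conj_argmax_G.
have [FC1 gradF] := conj_C1 modulus_gt0 modulus_star dual_midpoint HP.
exists (fun x => dotp (P x) x - dual (P x)); split => //.
- exact: conj_convex.
- by move=> x Cx; rewrite PG// dual_G// subKr.
- by move=> x Cx; rewrite gradF PG.
Qed.

End ConjugateOfExtension.

(** * Compactness arguments on pairs of points of [C] *)

Lemma compact_modulus2 (R : realType) (n : nat) (C : set 'rV[R]_n)
    (u v : 'rV[R]_n -> 'rV[R]_n -> R) (eps : R) :
  compact C ->
  continuous (fun t : subspace C * subspace C => u t.1 t.2) ->
  continuous (fun t : subspace C * subspace C => v t.1 t.2) ->
  (forall x y, C x -> C y -> 0 <= u x y) ->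
  (forall x y, C x -> C y -> u x y = 0 -> v x y <= 0) ->
  0 < eps -> exists2 mu : R, 0 < mu &
    forall x y, C x -> C y -> u x y < mu -> v x y < eps.
Proof.
move=> cC cu cv u0 uv e0.
have cC' : compact (C : set (subspace C)).
  by rewrite -[X in compact X]setIid; apply/compact_subspaceIP; rewrite setIid.
have [mu mu0 Hmu] := compact_modulus (compact_setX cC' cC')
  (continuous_subspaceT cu) (continuous_subspaceT cv)
  (fun t Ct => u0 t.1 t.2 Ct.1 Ct.2) (fun t Ct => uv t.1 t.2 Ct.1 Ct.2) e0.
by exists mu => // x y Cx Cy; exact: (Hmu (x, y)).
Qed.

Section WithinPairs.
Variables (R : realType) (n : nat) (C : set 'rV[R]_n).

Lemma within_fst_continuous (V : topologicalType) (g : 'rV[R]_n -> V) :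
  {within C, continuous g} ->
  continuous (fun t : subspace C * subspace C => g t.1).
Proof. by move=> cg t; apply: (cvg_comp _ _ cvg_fst); exact: cg. Qed.

Lemma within_snd_continuous (V : topologicalType) (g : 'rV[R]_n -> V) :
  {within C, continuous g} ->
  continuous (fun t : subspace C * subspace C => g t.2).
Proof. by move=> cg t; apply: (cvg_comp _ _ cvg_snd); exact: cg. Qed.

Lemma within_id_continuous : {within C, continuous (@id 'rV[R]_n)}.
Proof. by apply: continuous_subspaceT => x; exact: cvg_id. Qed.

Variables (G : 'rV[R]_n -> 'rV[R]_n).
Hypothesis cG : {within C, continuous G}.

Lemma within_sub_continuous :
  continuous (fun t : subspace C * subspace C => (G t.1 - G t.2 : 'rV[R]_n)).
Proof.
move=> t; apply: cvgB; first exact: within_fst_continuous.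
exact: within_snd_continuous.
Qed.

End WithinPairs.

(** Heine-Cantor, as the instance of [compact_modulus2] with [u] and [v] the distances before and
    after applying [G]. *)
Lemma compact_uniform_continuous (R : realType) (n : nat) (C : set 'rV[R]_n)
    (G : 'rV[R]_n -> 'rV[R]_n) (eps : R) :
  compact C -> {within C, continuous G} -> 0 < eps ->
  exists2 mu : R, 0 < mu &
    forall x y, C x -> C y -> `|x - y| < mu -> `|G x - G y| < eps.
Proof.
move=> cC cG; apply: (compact_modulus2 cC).
- move=> t; apply: cvg_norm.
  exact: (within_sub_continuous (@within_id_continuous R n C)).
- by move=> t; apply: cvg_norm; exact: (within_sub_continuous cG).
- by [].
- by move=> x y _ _ /normr0_eq0 /subr0_eq ->; rewrite subrr normr0.
Qed.

(** * Slopes, gradients and subgradients of convex functions *)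

Lemma convex_function_le (R : realType) (n : nat) (C : set 'rV[R]_n)
    (f : 'rV[R]_n -> R) (x y : 'rV[R]_n) (t : R) :
  convex_function C f -> C x -> C y -> 0 <= t -> t <= 1 ->
  f (y + t *: (x - y)) <= f y + t * (f x - f y).
Proof.
move=> cf Cx Cy t0 t1.
have := cf (Itv01 t0 t1) x y (mem_set Cx) (mem_set Cy).
have -> : conv (Itv01 t0 t1) (x : convex_lmodType _) y = y + t *: (x - y).
  change (t *: x + (1 - t) *: y = y + t *: (x - y)).
  by rewrite scalerBl scale1r scalerBr addrCA.
move=> /le_trans; apply.
change (t * f x + (1 - t) * f y <= f y + t * (f x - f y)).
lra.
Qed.

(** Convexity bounds the increment along the segment above by [t * (f x - f y)]; compare with the
    assumed lower bound and divide by a small [t]. The lower bound comes from differentiability in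
    [convex_gradient_ineq] and from condition (a) in [jet_bregman_ge0]. *)
Lemma convex_ge_slope (R : realType) (n : nat) (C : set 'rV[R]_n)
    (f : 'rV[R]_n -> R) (x y : 'rV[R]_n) (L : R) :
  convex_function C f -> C x -> C y ->
  (forall eps : R, 0 < eps -> exists2 delta : R, 0 < delta &
    forall t, 0 < t -> t <= 1 -> t < delta ->
      t * L - eps * t <= f (y + t *: (x - y)) - f y) ->
  L <= f x - f y.
Proof.
move=> cf Cx Cy H; apply/ler_addgt0Pr => eps /H[d d0 Hd].
pose t := Num.min 1 (d / 2).
have t0 : 0 < t by rewrite lt_min ltr01 divr_gt0.
have t1 : t <= 1 by rewrite ge_min lexx.
have td : t < d.
  by rewrite (@le_lt_trans _ _ (d / 2)) ?ge_min ?lexx ?orbT//; lra.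
have := Hd t t0 t1 td; have := convex_function_le cf Cx Cy (ltW t0) t1.
move=> h1 h2; have : t * L <= t * (f x - f y + eps) by lra.
by rewrite ler_pM2l.
Qed.

Lemma diff_directional (R : realType) (n : nat) (F : 'rV[R]_n -> R)
    (x v : 'rV[R]_n) (eps : R) :
  differentiable F x -> 0 < eps -> exists2 delta : R, 0 < delta &
    forall t, 0 < t -> t < delta ->
      `|F (x + t *: v) - F x - t * dotp (gradient F x) v| <= eps * t.
Proof.
move=> dF e0.
have /cvgrPdist_le/(_ _ e0) :
    h^-1 *: ((F \o shift x) (h *: v) - F x) @[h --> 0^'] --> 'D_v F x.
  exact: diff_derivable.
rewrite diff_gradient// near_withinE => /nbhs_normP[d /= d0 Hd].
exists d => // t t0 td.
have := Hd t; rewrite /= sub0r normrN gtr0_norm// gt_eqF// => /(_ td isT).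
rewrite distrC; set A := (X in `|X| <= eps) => H.
have -> : F (x + t *: v) - F x - t * dotp (gradient F x) v = t * A.
  by rewrite /A /GRing.scale/= mulrBr mulVKf ?gt_eqF// [X in F X]addrC.
by rewrite normrM gtr0_norm// mulrC ler_pM2r.
Qed.

Lemma convex_gradient_ineq (R : realType) (n : nat) (F : 'rV[R]_n -> R)
    (x y : 'rV[R]_n) :
  convex_function [set: 'rV[R]_n] F -> differentiable F y ->
  dotp (gradient F y) (x - y) <= F x - F y.
Proof.
move=> cF dF; apply: (convex_ge_slope cF) => // eps e0.
have [d d0 Hd] := diff_directional (x - y) dF e0.
exists d => // t t0 _ td; have := Hd t t0 td.
by rewrite ler_norml => /andP[]; lra.
Qed.

(** Moving from [x] in the direction [w = g - gradient F x] yields [dotp w w <= 0]. *)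
Lemma subgradient_gradient (R : realType) (n : nat) (F : 'rV[R]_n -> R)
    (x g : 'rV[R]_n) :
  differentiable F x -> (forall z, dotp g (z - x) <= F z - F x) ->
  gradient F x = g.
Proof.
move=> dF sub; set w := g - gradient F x.
have wle : dotp g w <= dotp (gradient F x) w.
  apply/ler_addgt0Pr => eps e0; have [d d0 Hd] := diff_directional w dF e0.
  have d20 : 0 < d / 2 by rewrite divr_gt0.
  have := Hd (d / 2) d20; have := sub (x + (d / 2) *: w).
  rewrite [x + _ - x]addrC addKr dotpZr ler_norml => h1.
  move=> /(_ ltac:(lra))/andP[_ h2].
  have : d / 2 * dotp g w <= d / 2 * (dotp (gradient F x) w + eps) by lra.
  by rewrite ler_pM2l.
have w0 : dotp w w <= 0 by rewrite {1}/w dotpDl dotpNl subr_le0.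
apply/esym/subr0_eq/eqP; rewrite -/w -normr_eq0 -sqrf_eq0 eq_le sqr_ge0 andbT.
exact: le_trans (sqr_norm_le_dotp _) w0.
Qed.

(** * Condition (a): necessity, and its consequences for [f] *)

Section Jet.
Variables (R : realType) (n : nat) (C : set 'rV[R]_n).
Variables (f : 'rV[R]_n -> R) (G : 'rV[R]_n -> 'rV[R]_n).
Implicit Types (x y z : 'rV[R]_n) (eps delta : R).

Definition uniform_jet := forall eps, 0 < eps -> exists2 delta, 0 < delta &
  forall y z, C y -> C z -> enorm (z - y) <= delta ->
    `|f z - f y - dotp (G y) (z - y)| <= eps * enorm (z - y).

Lemma extension_uniform_jet (F : 'rV[R]_n -> R) :
  compact C -> {within C, continuous G} ->
  convex_function [set: 'rV[R]_n] F -> (forall x, differentiable F x) ->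
  (forall x, C x -> F x = f x) -> (forall x, C x -> gradient F x = G x) ->
  uniform_jet.
Proof.
move=> cC cG cF dF Ff FG eps e0.
have e'0 : 0 < eps / (n%:R + 1) by rewrite divr_gt0 ?ltr_wpDl.
have [mu mu0 Hmu] := compact_uniform_continuous cC cG e'0.
(* Halving turns the non-strict bound of condition (a) into the strict one of [Hmu]. *)
exists (mu / 2) => [|y z Cy Cz yz]; first by rewrite divr_gt0.
have zy : `|z - y| < mu by have := norm_le_enorm (z - y); lra.
have Gzy := Hmu _ _ Cz Cy zy.
have := convex_gradient_ineq z cF (dF y).
have := convex_gradient_ineq y cF (dF z).
rewrite !FG// !Ff// -(opprB z y) dotpNr => h1 h2.
rewrite ger0_norm ?subr_ge0//.
apply: (@le_trans _ _ (dotp (G z - G y) (z - y))).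
  by rewrite dotpDl dotpNl; lra.
rewrite (le_trans (ler_norm _))// (le_trans (dotp_le_norm _ _))// mulrA.
apply: ler_pM => //; last exact: norm_le_enorm.
move: Gzy; rewrite ltr_pdivlMr ?ltr_wpDl// => /ltW; apply: le_trans.
by rewrite mulrC ler_wpM2l// lerDl.
Qed.

Hypothesis jet : uniform_jet.

Lemma jet_bregman_ge0 : convex_set C -> convex_function C f ->
  forall x y, C x -> C y -> 0 <= bregman f G x y.
Proof.
move=> convC cf x y Cx Cy; rewrite /bregman subr_ge0.
apply: (convex_ge_slope cf Cx Cy) => eps e0.
(* A positive bound for the Euclidean length of [x - y], so that the point at parameter [t] is
   within [t * K] of [y]. *)
pose K := n%:R * `|x - y| + 1.
have K0 : 0 < K by rewrite ltr_wpDl// mulr_ge0.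
have [d d0 Hd] := jet (divr_gt0 e0 K0).
exists (d / K) => [|t t0 t1]; first by rewrite divr_gt0.
rewrite ltr_pdivlMr// => td.
set z := y + t *: (x - y).
have Cz : C z.
  have := convC x y (Itv01 (ltW t0) t1) (mem_set Cx) (mem_set Cy).
  move=> /set_mem; congr C.
  change (t *: x + (1 - t) *: y = z).
  by rewrite scalerBl scale1r /z scalerBr addrCA.
have zy : z - y = t *: (x - y) by rewrite /z [y + _]addrC addrK.
have ezy : enorm (z - y) <= t * K.
  rewrite (le_trans (enorm_le_norm _))// zy normrZ gtr0_norm// mulrCA.
  by rewrite ler_wpM2l ?lerDl// ltW.
have := Hd _ _ Cy Cz (le_trans ezy (ltW td)).
have : eps / K * enorm (z - y) <= eps * t.
  apply: (le_trans (ler_wpM2l _ ezy)); first by apply: divr_ge0; exact: ltW.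
  by rewrite mulrCA divfK ?gt_eqF// mulrC.
rewrite zy dotpZr ler_norml => h /andP[h1 _]; lra.
Qed.

Lemma jet_within_continuous : {within C, continuous f}.
Proof.
rewrite continuous_subspace_in => y /set_mem Cy.
apply/cvgrPdist_lt => eps e0.
(* Condition (a) with epsilon 1 is enough: near [y] it gives [|f z - f y| <= K * |y - z|]. *)
have [d d0 Hd] := jet ltr01.
pose K := n%:R * (`|G y| + 1) + 1.
have K0 : 0 < K by rewrite ltr_wpDl// mulr_ge0// addr_ge0.
have K'0 : 0 < n%:R + 1 :> R by rewrite ltr_wpDl.
rewrite -nbhs_subspace_in//.
rewrite near_withinE; apply/(@nbhs_normP R _ y).
exists (Num.min (d / (n%:R + 1)) (eps / K)).
  by rewrite /= lt_min !divr_gt0.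
move=> z /=; rewrite lt_min !ltr_pdivlMr// => /andP[yzd yze] Cz.
have ezy : enorm (z - y) <= n%:R * `|y - z| by rewrite distrC enorm_le_norm.
have ezd : enorm (z - y) <= d.
  by rewrite (le_trans ezy)// (le_trans _ (ltW yzd))// mulrC ler_wpM2l// lerDl.
have := Hd _ _ Cy Cz ezd; rewrite mul1r => fz.
have := dotp_le_norm (G y) (z - y); rewrite (distrC z) => Gz.
apply: le_lt_trans yze.
rewrite distrC -[f z - f y](subrK (dotp (G y) (z - y))).
by rewrite (le_trans (ler_normD _ _))// /K; have := normr_ge0 (y - z); lra.
Qed.

End Jet.

Theorem theorem1p8 (R : realType) (n : nat) (C : set 'rV[R]_n)
    (f : 'rV[R]_n -> R) (G : 'rV[R]_n -> 'rV[R]_n)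
    (C_compact : compact C) (C_convex : convex_set C)
    (f_convex : convex_function C f)
    (G_continuous : {within C, continuous G}) :
  (exists F : 'rV[R]_n -> R,
     [/\ convex_function [set: 'rV[R]_n] F,
         C1 F,
         forall x, C x -> F x = f x
       & forall x, C x -> gradient F x = G x])
  <->
  ((forall eps : R, 0 < eps ->
      exists2 delta : R, 0 < delta &
        forall y z : 'rV[R]_n, C y -> C z -> enorm (z - y) <= delta ->
          `|f z - f y - dotp (G y) (z - y)| <= eps * enorm (z - y))
   /\
   (forall x y : 'rV[R]_n, C x -> C y ->
      f x - f y = dotp (G y) (x - y) -> G x = G y)).
Proof.
split=> [[F [cF [dF _] Ff FG]]|[jet tangent]].
  split; first exact: (extension_uniform_jet C_compact G_continuous cF dF).
  move=> x y Cx Cy xy; rewrite -FG//; apply: subgradient_gradient => // z.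
  have := convex_gradient_ineq z cF (dF y).
  rewrite FG// (Ff y)// (Ff x)//.
  (* The equality assumed in (b) moves the base point of the supporting plane from [y] to [x]. *)
  have -> : z - y = (z - x) + (x - y) by rewrite addrA subrK.
  rewrite dotpDr -xy; lra.
have [[y0 Cy0]|C0] := pselect (C !=set0); last first.
  (* For empty [C] the conditions on [C] are vacuous; the duality construction needs a point
     [y0]. *)
  exists (cst 0); split.
  - by move=> t x y _ _; rewrite /cst /= convmm.
  - split=> [x|]; first exact: differentiable_cst.
    suff -> : gradient (cst (0 : R)) = cst (0 : 'rV[R]_n).
      exact: cst_continuous.
    by apply/funext => x; apply/rowP => i; rewrite !mxE derive_cst.
  - by move=> x Cx; case: C0; exists x.
  - by move=> x Cx; case: C0; exists x.
have D0 := jet_bregman_ge0 jet C_convex f_convex.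
have cf := jet_within_continuous jet.
have bounded (V : normedModType R) (g : 'rV[R]_n -> V) :
    {within C, continuous g} ->
    exists2 M : R, 0 <= M & forall y, C y -> `|g y| <= M.
  move=> cg.
  have /ex_strict_bound_gt0[M M0 gM] :=
    compact_bounded (continuous_compact cg C_compact).
  by exists M; [exact: ltW|move=> y Cy; apply/ltW/gM; exists y].
have [B1 B10 C_bd] := bounded _ _ (@within_id_continuous R n C).
have [B2 B20 f_bd] := bounded _ _ cf.
have [B3 B30 G_bd] := bounded _ _ G_continuous.
apply: (@convex_C1_extension _ _ C f G D0 (B1 + B2 + B3) _ _ _ y0 Cy0).
- by move=> y Cy; rewrite (le_trans (C_bd _ Cy))//; lra.
- by move=> y Cy; rewrite (le_trans (f_bd _ Cy))//; lra.
- by move=> y Cy; rewrite (le_trans (G_bd _ Cy))//; lra.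
(* Condition (b) enters here: a vanishing [bregman x y] forces a vanishing gap, and compactness
   makes this quantitative. *)
move=> eps; apply: (compact_modulus2 C_compact) => //.
- move=> t.
  have ct := within_sub_continuous (@within_id_continuous R n C) (x := t).
  have cfst := @within_fst_continuous R n C R f cf t.
  have csnd := @within_snd_continuous R n C R f cf t.
  have cG := @within_snd_continuous R n C _ G G_continuous t.
  exact: (cvgB (cvgB cfst csnd) (cvg_dotp cG ct)).
- move=> t; have ct := within_sub_continuous G_continuous (x := t).
  exact: (cvg_dotp ct ct).
- by move=> x y Cx Cy /subr0_eq xy; rewrite (tangent x y)// subrr dotp0l.
Qed.
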